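(* Let $|q|<1$ and let $a,b,c$ be complex numbers. Let $\{\alpha_n\}_{n\ge0}$ be a sequence of complex numbers and define \[ \beta_m=\sum_{n=0}^m\frac{(b;q)_{m-n}}{(q;q)_{m-n}}\alpha_n\quad(m\ge0). \] Then, provided the series involved converge, \[ \sum_{m=0}^{\infty}\frac{(a;q)_m}{(c;q)_m}\left(\frac{c}{ab}\right)^m\beta_m =\frac{(c/a,c/b;q)_{\infty}}{(c,c/ab;q)_{\infty}}\sum_{k=0}^{\infty}\frac{(a;q)_k}{(c/b;q)_k}\left(\frac{c}{ab}\right)^k\alpha_k. \]
   Context: Notation: $(x;q)_n=(1-x)(1-xq)\cdots(1-xq^{n-1})$, $(x;q)_\infty=\prod_{i\ge0}(1-xq^i)$, $(x_1,\dots,x_r;q)_n=\prod_i(x_i;q)_n$. Parameters are assumed such that no denominator vanishes. Convergence is understood to include that of the double series $\sum_{m\ge n\ge0}\frac{(a;q)_m(b;q)_{m-n}(c/b;q)_n}{(c;q)_m(q;q)_{m-n}(a;q)_n}\left(\frac{c}{ab}\right)^{m-n}\frac{(a;q)_n}{(c/b;q)_n}\left(\frac{c}{ab}\right)^{n}\alpha_n$ obtained by substituting the definition of $\beta_m$, so that the order of summation may be interchanged. *)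

(* Defs.v *)
(* Stdlib reals with Coquelicot's complex numbers. *)
From Stdlib Require Import Reals.
From Coquelicot Require Import Coquelicot.
Open Scope C_scope.

Fixpoint qpoch (x q : C) (n : nat) : C :=
  match n with
  | O => 1
  | S k => qpoch x q k * (1 - x * q ^ k)
  end.

(* The limit of (x;q)_n, taken on real and imaginary parts; it is meaningful
   for |q| < 1, where the infinite product converges. *)
Definition qpoch_inf (x q : C) : C :=
  (real (Lim_seq (fun n => Re (qpoch x q n))),
   real (Lim_seq (fun n => Im (qpoch x q n)))).

(* Regular convergence (Hardy): the rectangular partial sums converge as both
   bounds tend to infinity independently, and every row and every column
   converges.  Both iterated sums of such a double series exist and agree;
   absolute convergence is a special case. *)
Definition ex_double_series (t : nat -> nat -> C) : Prop :=
  (exists s : C,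
     filterlim
       (fun p : nat * nat => sum_n (fun m => sum_n (fun n => t m n) (snd p)) (fst p))
       (filter_prod eventually eventually) (locally s))
  /\ (forall m : nat, ex_series (fun n => t m n))
  /\ (forall n : nat, ex_series (fun m => t m n)).

(* Main.v *)
Require Import Defs.
From Stdlib Require Import Reals Lra Lia.
From Coquelicot Require Import Coquelicot.
Open Scope C_scope.

(* Summing the double series by columns, column n is a multiple of the
   2phi1 series of Gauss with parameters a q^n, b and c q^n, so everything
   reduces to the q-Gauss sum.  Writing c = abz, a telescoping identity gives
   (1 - c)(1 - z) S(z) = (1 - az)(1 - bz) S(zq), and S(z q^n) -> 1 because the
   k-th term is bounded by (K |z| |q|^n)^k.  This argument uses only the
   convergence of S(z), hence it also covers the terminating series with
   |z| >= 1. *)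

(** * Limits of complex sequences and of double sequences *)

(** Stated through the real sequence of distances, so that squeezing and limit arithmetic for
    [is_lim_seq] apply directly; [Clim_filterlim] links it to filters. *)
Definition Clim (u : nat -> C) (l : C) : Prop :=
  is_lim_seq (fun n => Cmod (u n - l)) 0.

Lemma Clim_eps (u : nat -> C) (l : C) :
  Clim u l <->
  forall eps : posreal, exists N, forall n, (N <= n)%nat -> (Cmod (u n - l) < eps)%R.
Proof.
  unfold Clim. rewrite <- is_lim_seq_spec. unfold is_lim_seq', eventually.
  split; intros H eps; destruct (H eps) as [N HN]; exists N; intros n Hn;
    specialize (HN n Hn); rewrite Rminus_0_r, (Rabs_pos_eq _ (Cmod_ge_0 _)) in *;
    exact HN.
Qed.

Lemma Clim_filterlim (u : nat -> C) (l : C) :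
  Clim u l <-> filterlim u eventually (locally l).
Proof.
  rewrite Clim_eps. symmetry.
  exact (filterlim_locally_ball_norm (U := C_NormedModule) u l).
Qed.

Lemma is_series_Clim (u : nat -> C) (l : C) :
  is_series u l <-> Clim (sum_n u) l.
Proof. symmetry. apply Clim_filterlim. Qed.

Lemma Clim_unique (u : nat -> C) (l l' : C) : Clim u l -> Clim u l' -> l = l'.
Proof.
  rewrite !Clim_filterlim.
  exact (filterlim_locally_unique (V := C_NormedModule) u l l').
Qed.

Lemma Clim_le (u : nat -> C) (l : C) (v : nat -> R) :
  (forall n, (Cmod (u n - l) <= v n)%R) -> is_lim_seq v 0 -> Clim u l.
Proof.
  intros H Hv. unfold Clim.
  apply (is_lim_seq_le_le (fun _ => 0%R) _ v); [| apply is_lim_seq_const | exact Hv].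
  intros n. split; [apply Cmod_ge_0 | apply H].
Qed.

Lemma Clim_const (l : C) : Clim (fun _ => l) l.
Proof.
  apply Clim_le with (v := fun _ => 0%R); [| apply is_lim_seq_const].
  intros _. replace (l - l) with (RtoC 0) by ring. rewrite Cmod_0. lra.
Qed.

Lemma Clim_ext_loc (u v : nat -> C) (l : C) (N : nat) :
  (forall n, (N <= n)%nat -> u n = v n) -> Clim u l -> Clim v l.
Proof.
  intros H. apply is_lim_seq_ext_loc. exists N. intros n Hn. now rewrite H.
Qed.

Lemma Clim_ext (u v : nat -> C) (l : C) :
  (forall n, u n = v n) -> Clim u l -> Clim v l.
Proof. intros H. apply (Clim_ext_loc _ _ _ 0). auto. Qed.

Lemma Clim_plus (u v : nat -> C) (l m : C) :
  Clim u l -> Clim v m -> Clim (fun n => u n + v n) (l + m).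
Proof.
  intros Hu Hv.
  apply Clim_le with (v := fun n => (Cmod (u n - l) + Cmod (v n - m))%R).
  - intros n. replace (u n + v n - (l + m)) with ((u n - l) + (v n - m)) by ring.
    apply Cmod_triangle.
  - replace 0%R with (0 + 0)%R by ring. now apply is_lim_seq_plus'.
Qed.

Lemma Clim_mult (u v : nat -> C) (l m : C) :
  Clim u l -> Clim v m -> Clim (fun n => u n * v n) (l * m).
Proof.
  intros Hu Hv.
  apply Clim_le with (v := fun n => (Cmod (u n - l) * Cmod (v n - m)
    + (Cmod l * Cmod (v n - m) + Cmod m * Cmod (u n - l)))%R).
  - intros n. rewrite <- !Cmod_mult.
    replace (u n * v n - l * m)
      with ((u n - l) * (v n - m) + (l * (v n - m) + m * (u n - l))) by ring.
    eapply Rle_trans; [apply Cmod_triangle | apply Rplus_le_compat_l, Cmod_triangle].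
  - replace 0%R with (0 * 0 + (Cmod l * 0 + Cmod m * 0))%R by ring.
    apply is_lim_seq_plus'; [| apply is_lim_seq_plus'];
      apply is_lim_seq_mult'; auto using is_lim_seq_const.
Qed.

Lemma Clim_scal (k : C) (u : nat -> C) (l : C) :
  Clim u l -> Clim (fun n => k * u n) (k * l).
Proof. apply Clim_mult, Clim_const. Qed.

Lemma Clim_one_minus (u : nat -> C) : Clim u 0 -> Clim (fun n => 1 - u n) 1.
Proof.
  intros Hu.
  pose proof (Clim_plus _ _ _ _ (Clim_const 1) (Clim_scal (- (1)) _ _ Hu)) as H.
  rewrite Cmult_0_r, Cplus_0_r in H.
  revert H. apply Clim_ext. intros n. ring.
Qed.

Lemma Clim_incr_n (k : nat) (u : nat -> C) (l : C) :
  Clim u l -> Clim (fun n => u (n + k)%nat) l.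
Proof. apply (is_lim_seq_incr_n (fun n => Cmod (u n - l)) k). Qed.

Lemma Clim_decr_n (k : nat) (u : nat -> C) (l : C) :
  Clim (fun n => u (n + k)%nat) l -> Clim u l.
Proof. apply (is_lim_seq_incr_n (fun n => Cmod (u n - l)) k). Qed.

Lemma Clim_Cmod (u : nat -> C) (l : C) :
  Clim u l -> is_lim_seq (fun n => Cmod (u n)) (Cmod l).
Proof.
  rewrite Clim_filterlim. intros H.
  exact (filterlim_comp _ _ _ _ _ _ _ _ H
    (filterlim_norm (V := C_NormedModule) l)).
Qed.

Lemma Clim_Re (u : nat -> C) (l : C) :
  Clim u l -> is_lim_seq (fun n => Re (u n)) (Re l).
Proof.
  rewrite Clim_filterlim. intros H.
  apply (filterlim_comp _ _ _ _ _ _ _ _ H).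
  intros P [e HP]. exists e. intros y [Hy _]. now apply HP.
Qed.

Lemma Clim_Im (u : nat -> C) (l : C) :
  Clim u l -> is_lim_seq (fun n => Im (u n)) (Im l).
Proof.
  rewrite Clim_filterlim. intros H.
  apply (filterlim_comp _ _ _ _ _ _ _ _ H).
  intros P [e HP]. exists e. intros y [_ Hy]. now apply HP.
Qed.

Lemma Clim_dist_le (u : nat -> C) (l x : C) (r : R) :
  Clim u l -> (forall n, (Cmod (u n - x) <= r)%R) -> (Cmod (l - x) <= r)%R.
Proof.
  intros Hu H.
  apply (is_lim_seq_le (fun n => Cmod (u n - x)) (fun _ => r)
    (Cmod (l - x)) r); [exact H | | apply is_lim_seq_const].
  apply Clim_Cmod, Clim_plus; [exact Hu | apply Clim_const].
Qed.

Lemma Clim_pow (q : C) : (Cmod q < 1)%R -> Clim (fun n => q ^ n) 0.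
Proof.
  intros Hq. apply Clim_le with (v := fun n => (Cmod q ^ n)%R).
  - intros n. replace (q ^ n - 0) with (q ^ n) by ring. rewrite Cmod_pow. lra.
  - apply is_lim_seq_geom. rewrite Rabs_pos_eq; auto using Cmod_ge_0.
Qed.

Lemma is_series_term_0 (u : nat -> C) (l : C) : is_series u l -> Clim u 0.
Proof.
  rewrite is_series_Clim. intros H. apply (Clim_decr_n 1).
  apply (Clim_ext (fun n => sum_n u (n + 1) + (-(1)) * sum_n u n)).
  - intros n. rewrite Nat.add_1_r, sum_Sn. change plus with Cplus. ring.
  - replace (RtoC 0) with (l + (-(1)) * l) by ring.
    apply Clim_plus; [now apply (Clim_incr_n 1) | now apply Clim_scal].
Qed.

(** The increments are dominated by a geometric series, so their series converges by completeness,
    and its partial sums telescope to [u (S n) - u 0]. *)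
Lemma Clim_of_diff_le (u : nat -> C) (B r : R) :
  (0 <= r < 1)%R ->
  (forall n, (Cmod (u (S n) - u n) <= B * r ^ n)%R) -> exists l, Clim u l.
Proof.
  intros Hr H.
  destruct (ex_series_le (V := C_CompleteNormedModule)
    (fun n => u (S n) - u n) (fun n => (B * r ^ n)%R) H) as [s Hs].
  { apply (ex_series_scal_l (K := R_AbsRing) (V := R_NormedModule) B).
    apply ex_series_geom. rewrite Rabs_pos_eq; lra. }
  exists (s + u 0%nat). apply (Clim_decr_n 1).
  apply (Clim_ext (fun n => sum_n (fun n => u (S n) - u n) n + u 0%nat)).
  - intros n. rewrite Nat.add_1_r. induction n as [|n IH].
    + rewrite sum_O. ring.
    + rewrite sum_Sn. change plus with Cplus.
      transitivity (sum_n (fun n => u (S n) - u n) n + u 0%nat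
                    + (u (S (S n)) - u (S n))); [ring |]. rewrite IH. ring.
  - apply Clim_plus; [now apply is_series_Clim | apply Clim_const].
Qed.

(** Once both indices are large, [s m n] is close to [l]; letting [n] tend to infinity with [m]
    fixed keeps the row limit [r m] in the closed ball around [l]. *)
Lemma double_limit_iterated (s : nat -> nat -> C) (r : nat -> C) (l L : C) :
  filterlim (fun p : nat * nat => s (fst p) (snd p))
    (filter_prod eventually eventually) (locally l) ->
  (forall m, Clim (s m) (r m)) -> Clim r L -> L = l.
Proof.
  intros Hs Hr HL. apply (Clim_unique r); [exact HL |]. apply Clim_eps. intros eps.
  (* Passing to the limit weakens [<] to [<=]; starting from [eps / 2] restores the strict bound. *)
  assert (He : (0 < eps / 2)%R) by (destruct eps; simpl; lra).
  pose proof (proj1 (filterlim_locally_ball_norm (U := C_NormedModule) _ l)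
    Hs (mkposreal _ He)) as H.
  destruct H as [P Q [N HN] [N' HN'] H].
  exists N. intros m Hm.
  apply Rle_lt_trans with (eps / 2)%R; [| destruct eps; simpl; lra].
  apply (Clim_dist_le (fun n => s m (n + N')%nat)); [now apply Clim_incr_n |].
  intros n. left. apply (H m (n + N')%nat); [now apply HN | apply HN'; lia].
Qed.

(** * Finite and infinite [q]-Pochhammer symbols *)

Lemma one_minus_neq_0 (x : C) : (Cmod x < 1)%R -> 1 - x <> 0.
Proof.
  intros Hx E. assert (H : x = 1) by (transitivity (1 - (1 - x)); [ring | rewrite E; ring]).
  rewrite H, Cmod_1 in Hx. lra.
Qed.

Lemma Cmod_one_minus_le (x : C) : (Cmod (1 - x) <= 1 + Cmod x)%R.
Proof.
  rewrite <- Cmod_1 at 2. rewrite <- (Cmod_opp x). apply Cmod_triangle.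
Qed.

Lemma Cmod_one_minus_ge (x : C) : (1 - Cmod x <= Cmod (1 - x))%R.
Proof.
  pose proof (Cmod_triangle (1 - x) x) as H.
  replace (1 - x + x) with (RtoC 1) in H by ring. rewrite Cmod_1 in H. lra.
Qed.

Lemma Cmod_pow_le_1 (q : C) (n : nat) : (Cmod q < 1)%R -> (Cmod (q ^ n) <= 1)%R.
Proof.
  intros Hq. rewrite Cmod_pow, <- (pow1 n). apply pow_incr.
  split; [apply Cmod_ge_0 | lra].
Qed.

Lemma qpoch_add (x q : C) (n k : nat) :
  qpoch x q (n + k) = qpoch x q n * qpoch (x * q ^ n) q k.
Proof.
  induction k as [|k IH]; simpl.
  - rewrite Nat.add_0_r. ring.
  - rewrite Nat.add_succ_r. simpl. rewrite IH, Cpow_add_r. ring.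
Qed.

Lemma qpoch_S_l (x q : C) (k : nat) :
  qpoch x q (S k) = (1 - x) * qpoch (x * q) q k.
Proof.
  rewrite <- (Nat.add_1_l k), qpoch_add. simpl.
  replace (x * (q * 1)) with (x * q) by ring. ring.
Qed.

Lemma qpoch_neq_0_factor (x q : C) (k : nat) :
  qpoch x q (S k) <> 0 -> 1 - x * q ^ k <> 0.
Proof. intros H E. apply H. simpl. rewrite E. ring. Qed.

Lemma qpoch_neq_0_shift (x q : C) (n : nat) :
  (forall k, qpoch x q k <> 0) -> forall k, qpoch (x * q ^ n) q k <> 0.
Proof.
  intros H k E. apply (H (n + k)%nat). rewrite qpoch_add, E. ring.
Qed.

Lemma qpoch_q_neq_0 (q : C) (n : nat) : (Cmod q < 1)%R -> qpoch q q n <> 0.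
Proof.
  intros Hq. induction n as [|n IH]; simpl.
  - apply C1_nz.
  - apply Cmult_neq_0; [exact IH |]. apply one_minus_neq_0.
    rewrite Cmod_mult. pose proof (Cmod_pow_le_1 q n Hq).
    pose proof (Cmod_ge_0 q). nra.
Qed.

(** Each factor is at most [1 + |x| |q|^i <= exp (|x| |q|^i)], and the exponents form a geometric
    series; the bound is uniform in [n]. *)
Lemma Cmod_qpoch_le_exp (x q : C) (n : nat) :
  (Cmod q < 1)%R -> (Cmod (qpoch x q n) <= exp (Cmod x / (1 - Cmod q)))%R.
Proof.
  intros Hq. pose proof (Cmod_ge_0 q) as Hq0. pose proof (Cmod_ge_0 x) as Hx0.
  (* The induction runs on the finite geometric sum in the exponent, which is then replaced by the
     full one. *)
  apply Rle_trans with (exp (Cmod x * (1 - Cmod q ^ n) / (1 - Cmod q))).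
  - induction n as [|n IH]; simpl.
    + rewrite Cmod_1, Rminus_diag, Rmult_0_r. unfold Rdiv.
      rewrite Rmult_0_l, exp_0. lra.
    + rewrite Cmod_mult.
      replace (Cmod x * (1 - Cmod q * Cmod q ^ n) / (1 - Cmod q))%R
        with (Cmod x * (1 - Cmod q ^ n) / (1 - Cmod q) + Cmod x * Cmod q ^ n)%R
        by (field; lra).
      rewrite exp_plus. apply Rmult_le_compat; auto using Cmod_ge_0.
      eapply Rle_trans; [apply Cmod_one_minus_le |].
      rewrite Cmod_mult, Cmod_pow. apply exp_ineq1_le.
  - assert (0 <= Cmod q ^ n)%R by now apply pow_le.
    assert (Hle : (Cmod x * (1 - Cmod q ^ n) / (1 - Cmod q) <= Cmod x / (1 - Cmod q))%R).
    { apply Rmult_le_compat_r; [left; apply Rinv_0_lt_compat; lra | nra]. }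
    destruct Hle as [Hlt | ->]; [left; now apply exp_increasing | lra].
Qed.

(** Consecutive symbols differ by [- (x;q)_n x q^n], which is geometrically small by the uniform
    bound. *)
Lemma Clim_qpoch (x q : C) : (Cmod q < 1)%R -> Clim (qpoch x q) (qpoch_inf x q).
Proof.
  intros Hq.
  destruct (Clim_of_diff_le (qpoch x q)
    (exp (Cmod x / (1 - Cmod q)) * Cmod x)%R (Cmod q)) as [l Hl].
  - split; [apply Cmod_ge_0 | exact Hq].
  - intros n. simpl.
    replace (qpoch x q n * (1 - x * q ^ n) - qpoch x q n)
      with (- (qpoch x q n * (x * q ^ n))) by ring.
    rewrite Cmod_opp, !Cmod_mult, Cmod_pow, Rmult_assoc.
    apply Rmult_le_compat_r; [| now apply Cmod_qpoch_le_exp].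
    apply Rmult_le_pos; [apply Cmod_ge_0 | apply pow_le, Cmod_ge_0].
  - replace (qpoch_inf x q) with l; [exact Hl |]. unfold qpoch_inf.
    rewrite (is_lim_seq_unique _ _ (Clim_Re _ _ Hl)),
      (is_lim_seq_unique _ _ (Clim_Im _ _ Hl)).
    apply surjective_pairing.
Qed.

Lemma qpoch_inf_split (x q : C) (n : nat) :
  (Cmod q < 1)%R -> qpoch_inf x q = qpoch x q n * qpoch_inf (x * q ^ n) q.
Proof.
  intros Hq. apply (Clim_unique (fun k => qpoch x q (k + n)%nat)).
  - apply Clim_incr_n. now apply Clim_qpoch.
  - apply (Clim_ext (fun k => qpoch x q n * qpoch (x * q ^ n) q k)).
    + intros k. now rewrite Nat.add_comm, qpoch_add.
    + now apply Clim_scal, Clim_qpoch.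
Qed.

(** * The contiguous relation between arguments [z] and [z q] of the Gauss series *)

(* The series 2phi1(a,b;c;q,z) of Gauss, parametrized by z instead of c = abz
   so that it also makes sense for [a = 0], which occurs as [a * q ^ n]. *)
Definition gauss_term (q a b z : C) (k : nat) : C :=
  qpoch a q k * qpoch b q k / (qpoch (a * b * z) q k * qpoch q q k) * z ^ k.

(** With [c = abz], passing from [z] to [z q] also moves [c] to [c q]; the two denominators are
    related by [(1 - c) (cq;q)_k = (c;q)_k (1 - c q^k)]. *)
Lemma gauss_term_shift (q a b z : C) (k : nat) :
  (Cmod q < 1)%R ->
  (forall n, qpoch (a * b * z) q n <> 0) ->
  gauss_term q a b (z * q) k * (1 - a * b * z * q ^ k)
  = (1 - a * b * z) * q ^ k * gauss_term q a b z k.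
Proof.
  intros Hq Hc. unfold gauss_term.
  pose proof (qpoch_q_neq_0 q k Hq) as H1. pose proof (Hc k) as H2.
  pose proof (qpoch_neq_0_factor _ _ _ (Hc (S k))) as H3.
  pose proof (qpoch_neq_0_factor _ _ _ (Hc 1%nat)) as H4.
  assert (H5 : qpoch (a * b * (z * q)) q k <> 0).
  { replace (a * b * (z * q)) with (a * b * z * q ^ 1) by (simpl; ring).
    now apply qpoch_neq_0_shift. }
  assert (E : qpoch (a * b * (z * q)) q k
    = qpoch (a * b * z) q k * (1 - a * b * z * q ^ k) / (1 - a * b * z)).
  { replace (a * b * (z * q)) with (a * b * z * q) by ring.
    change (qpoch (a * b * z) q k * (1 - a * b * z * q ^ k))
      with (qpoch (a * b * z) q (S k)).
    rewrite qpoch_S_l. field. simpl in H4. now rewrite Cmult_1_r in H4. }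
  simpl in H4. rewrite Cmult_1_r in H4.
  rewrite E, Cpow_mult_l. field. repeat split; assumption.
Qed.

(* Found with q-Zeilberger: the certificate is [1 - q ^ k]. *)
Lemma gauss_term_telescope (q a b z : C) (k : nat) :
  (Cmod q < 1)%R ->
  (forall n, qpoch (a * b * z) q n <> 0) ->
  (1 - a * b * z) * (1 - z) * gauss_term q a b z k
  - (1 - a * z) * (1 - b * z) * gauss_term q a b (z * q) k
  = (1 - a * b * z) * ((1 - q ^ k) * gauss_term q a b z k
      - (1 - q ^ S k) * gauss_term q a b z (S k)).
Proof.
  intros Hq Hc.
  pose proof (qpoch_q_neq_0 q k Hq) as H1. pose proof (Hc k) as H2.
  pose proof (qpoch_neq_0_factor _ _ _ (Hc (S k))) as H3.
  pose proof (qpoch_neq_0_factor _ _ _ (qpoch_q_neq_0 q (S k) Hq)) as H4.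
  (* Both other terms are written as rational multiples of the [k]-th term, so that the claim
     becomes an identity of rational functions. *)
  assert (E1 : gauss_term q a b (z * q) k
    = (1 - a * b * z) * q ^ k * gauss_term q a b z k / (1 - a * b * z * q ^ k)).
  { rewrite <- gauss_term_shift by assumption. field. exact H3. }
  assert (E2 : gauss_term q a b z (S k)
    = gauss_term q a b z k * (1 - a * q ^ k) * (1 - b * q ^ k) * z
      / ((1 - a * b * z * q ^ k) * (1 - q * q ^ k))).
  { unfold gauss_term. simpl. field. repeat split; assumption. }
  rewrite E1, E2. rewrite Cpow_S. field. split; assumption.
Qed.

(** Summing [gauss_term_telescope] leaves only the upper boundary term, since the lower one carries
    the factor [1 - q ^ 0 = 0]. *)
Lemma gauss_sum_telescope (q a b z : C) (n : nat) :
  (Cmod q < 1)%R ->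
  (forall n, qpoch (a * b * z) q n <> 0) ->
  (1 - a * b * z) * (1 - z) * sum_n (gauss_term q a b z) n
  + (1 - a * b * z) * ((1 - q ^ S n) * gauss_term q a b z (S n))
  = (1 - a * z) * (1 - b * z) * sum_n (gauss_term q a b (z * q)) n.
Proof.
  intros Hq Hc. induction n as [|n IH].
  - rewrite !sum_O. pose proof (gauss_term_telescope q a b z 0 Hq Hc) as H.
    replace (q ^ 0) with (RtoC 1) in H by reflexivity.
    transitivity ((1 - a * z) * (1 - b * z) * gauss_term q a b (z * q) 0
      + ((1 - a * b * z) * (1 - z) * gauss_term q a b z 0
         - (1 - a * z) * (1 - b * z) * gauss_term q a b (z * q) 0)
      + (1 - a * b * z) * ((1 - q ^ 1) * gauss_term q a b z 1)); [ring |].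
    rewrite H. ring.
  - rewrite !sum_Sn. change plus with Cplus.
    pose proof (gauss_term_telescope q a b z (S n) Hq Hc) as H.
    transitivity (((1 - a * b * z) * (1 - z) * sum_n (gauss_term q a b z) n
      + (1 - a * b * z) * ((1 - q ^ S n) * gauss_term q a b z (S n)))
      + (((1 - a * b * z) * (1 - z) * gauss_term q a b z (S n)
         - (1 - a * z) * (1 - b * z) * gauss_term q a b (z * q) (S n))
         + (1 - a * z) * (1 - b * z) * gauss_term q a b (z * q) (S n))
      + (1 - a * b * z) * ((1 - q ^ S (S n)) * gauss_term q a b z (S (S n))
        - (1 - q ^ S n) * gauss_term q a b z (S n))); [ring |].
    rewrite H, IH. ring.
Qed.

(** By [gauss_term_shift] the terms at [z q] are [q ^ k] times a bounded sequence, so the new series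
    converges by comparison; the relation is the limit of [gauss_sum_telescope]. *)
Lemma gauss_contiguous (q a b z S : C) :
  (Cmod q < 1)%R -> (forall n, qpoch (a * b * z) q n <> 0) ->
  is_series (gauss_term q a b z) S ->
  exists S', is_series (gauss_term q a b (z * q)) S' /\
    (1 - a * b * z) * (1 - z) * S = (1 - a * z) * (1 - b * z) * S'.
Proof.
  intros Hq Hc HS.
  pose proof (is_series_term_0 _ _ HS) as Ht.
  assert (Hd : Clim (fun k => 1 - a * b * z * q ^ k) 1).
  { apply Clim_one_minus. rewrite <- (Cmult_0_r (a * b * z)).
    now apply Clim_scal, Clim_pow. }
  apply Clim_Cmod in Hd. rewrite Cmod_1 in Hd.
  apply is_lim_seq_inv in Hd; [| injection; lra].
  (* The terms tend to 0 and [1 / |1 - abz q^k|] tends to 1, so their product converges and is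
     bounded by some [M]. *)
  pose proof (is_lim_seq_mult' _ _ _ _ (Clim_Cmod _ _ Ht) Hd) as Hb.
  destruct (filterlim_bounded (V := R_NormedModule) _
    (ex_intro (fun y : R => filterlim _ eventually (locally y)) _ Hb)) as [M HM].
  destruct (ex_series_le (V := C_CompleteNormedModule) (gauss_term q a b (z * q))
    (fun k => (Cmod (1 - a * b * z) * M) * Cmod q ^ k)%R) as [S' HS'].
  - intros k. change norm with Cmod.
    pose proof (qpoch_neq_0_factor _ _ _ (Hc (Datatypes.S k))) as Hk.
    replace (gauss_term q a b (z * q) k)
      with ((1 - a * b * z) * q ^ k * gauss_term q a b z k / (1 - a * b * z * q ^ k)).
    2:{ rewrite <- gauss_term_shift by assumption. field. exact Hk. }
    rewrite Cmod_div, !Cmod_mult, Cmod_pow by exact Hk.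
    specialize (HM k). change norm with Rabs in HM.
    apply Rle_trans with (Cmod (1 - a * b * z) * Cmod q ^ k
      * (Cmod (gauss_term q a b z k) * / Cmod (1 - a * b * z * q ^ k)))%R;
      [right; unfold Rdiv; ring |].
    apply Rle_trans with (Cmod (1 - a * b * z) * Cmod q ^ k * M)%R; [| right; ring].
    apply Rmult_le_compat_l.
    + apply Rmult_le_pos; [| apply pow_le]; apply Cmod_ge_0.
    + eapply Rle_trans; [apply Rle_abs | exact HM].
  - apply (ex_series_scal_l (K := R_AbsRing) (V := R_NormedModule)).
    apply ex_series_geom. rewrite Rabs_pos_eq; auto using Cmod_ge_0.
  - exists S'. split; [exact HS' |].
    apply is_series_Clim in HS. apply is_series_Clim in HS'.
    apply (Clim_unique
      (fun n => (1 - a * z) * (1 - b * z) * sum_n (gauss_term q a b (z * q)) n));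
      [| now apply Clim_scal].
    eapply Clim_ext; [intros n; now apply gauss_sum_telescope |].
    (* The boundary term vanishes in the limit: [1 - q ^ S n] tends to 1, and the next term of the
       convergent series tends to 0. *)
    replace ((1 - a * b * z) * (1 - z) * S)
      with ((1 - a * b * z) * (1 - z) * S + (1 - a * b * z) * (1 * 0))
      by ring.
    apply Clim_plus; [now apply Clim_scal |]. apply Clim_scal.
    apply Clim_mult.
    + apply Clim_one_minus. generalize (Clim_incr_n 1 _ _ (Clim_pow q Hq)).
      apply Clim_ext. intros n. now rewrite Nat.add_1_r.
    + apply (Clim_incr_n 1) in Ht. revert Ht. apply Clim_ext.
      intros n. now rewrite Nat.add_1_r.
Qed.

(** The factors met along [z, zq, zq^2, ...] accumulate into symbols of length [n]. The relation
    stays cross-multiplied because factors such as [1 - z q^i] and [1 - az q^i] may vanish. *)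
Lemma gauss_contiguous_iter (q a b z S : C) (n : nat) :
  (Cmod q < 1)%R -> (forall n, qpoch (a * b * z) q n <> 0) ->
  is_series (gauss_term q a b z) S ->
  exists S', is_series (gauss_term q a b (z * q ^ n)) S' /\
    qpoch (a * b * z) q n * qpoch z q n * S
    = qpoch (a * z) q n * qpoch (b * z) q n * S'.
Proof.
  intros Hq Hc HS. induction n as [|n [S1 [H1 E1]]].
  - exists S. split; [| simpl; ring]. simpl. now rewrite Cmult_1_r.
  - destruct (gauss_contiguous q a b (z * q ^ n) S1 Hq) as [S2 [H2 E2]].
    + intros k. replace (a * b * (z * q ^ n)) with (a * b * z * q ^ n) by ring.
      now apply qpoch_neq_0_shift.
    + exact H1.
    + exists S2. split.
      * replace (z * q ^ Datatypes.S n) with (z * q ^ n * q); [exact H2 |].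
        rewrite Cpow_S. ring.
      * simpl.
        transitivity ((qpoch (a * b * z) q n * qpoch z q n * S)
          * ((1 - a * b * z * q ^ n) * (1 - z * q ^ n))); [ring |].
        rewrite E1.
        transitivity (qpoch (a * z) q n * qpoch (b * z) q n
          * ((1 - a * b * (z * q ^ n)) * (1 - z * q ^ n) * S1)); [ring |].
        rewrite E2. ring.
Qed.

(** * Behaviour of the Gauss series near [z = 0] and the [q]-Gauss sum *)

(** A bound of the form [r ^ k], unlike the uniform exponential one, merges with [z ^ k] when a
    whole term is estimated. *)
Lemma Cmod_qpoch_le_pow (x q : C) (k : nat) :
  (Cmod q < 1)%R -> (Cmod (qpoch x q k) <= (1 + Cmod x) ^ k)%R.
Proof.
  intros Hq. induction k as [|k IH]; simpl.
  - rewrite Cmod_1. lra.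
  - rewrite Cmod_mult, Rmult_comm. apply Rmult_le_compat; auto using Cmod_ge_0.
    eapply Rle_trans; [apply Cmod_one_minus_le |]. rewrite Cmod_mult.
    pose proof (Cmod_pow_le_1 q k Hq). pose proof (Cmod_ge_0 x). nra.
Qed.

Lemma Cmod_qpoch_ge_pow (x q : C) (k : nat) :
  (Cmod q < 1)%R -> (Cmod x <= 1)%R -> ((1 - Cmod x) ^ k <= Cmod (qpoch x q k))%R.
Proof.
  intros Hq Hx. induction k as [|k IH]; simpl.
  - rewrite Cmod_1. lra.
  - rewrite Cmod_mult, Rmult_comm. apply Rmult_le_compat; [apply pow_le; lra | lra | exact IH |].
    eapply Rle_trans; [| apply Cmod_one_minus_ge]. rewrite Cmod_mult.
    pose proof (Cmod_pow_le_1 q k Hq). pose proof (Cmod_ge_0 x). nra.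
Qed.

(** The denominator factors are at least [1/2], because [|abz| <= 1/2], and at least [1 - |q|];
    together they give the constant [2 / (1 - |q|)]. *)
Lemma Cmod_gauss_term_le (q a b z : C) (k : nat) :
  (Cmod q < 1)%R -> (Cmod (a * b * z) <= / 2)%R ->
  (Cmod (gauss_term q a b z k)
   <= ((1 + Cmod a) * (1 + Cmod b) * (2 / (1 - Cmod q)) * Cmod z) ^ k)%R.
Proof.
  intros Hq Hc. pose proof (Cmod_ge_0 q) as Hq0.
  assert (Hp : forall x, (/ 2 <= 1 - Cmod x)%R -> ((/ 2) ^ k <= Cmod (qpoch x q k))%R).
  { intros x Hx. eapply Rle_trans; [| apply Cmod_qpoch_ge_pow; lra].
    apply pow_incr. lra. }
  assert (H1 : (0 < (/ 2) ^ k)%R) by (apply pow_lt; lra).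
  assert (H2 : (0 < (1 - Cmod q) ^ k)%R) by (apply pow_lt; lra).
  assert (H3 : ((/ 2) ^ k <= Cmod (qpoch (a * b * z) q k))%R) by (apply Hp; lra).
  assert (H4 : ((1 - Cmod q) ^ k <= Cmod (qpoch q q k))%R)
    by (apply Cmod_qpoch_ge_pow; lra).
  assert (Hn : qpoch (a * b * z) q k * qpoch q q k <> 0).
  { apply Cmult_neq_0; apply Cmod_gt_0; lra. }
  unfold gauss_term. rewrite Cmod_mult, Cmod_div, !Cmod_mult, Cmod_pow by exact Hn.
  rewrite !Rpow_mult_distr. unfold Rdiv.
  apply Rmult_le_compat_r; [apply pow_le, Cmod_ge_0 |].
  apply Rmult_le_compat.
  - apply Rmult_le_pos; apply Cmod_ge_0.
  - left. apply Rinv_0_lt_compat. apply Rmult_lt_0_compat; lra.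
  - apply Rmult_le_compat; auto using Cmod_ge_0, Cmod_qpoch_le_pow.
  - rewrite Rpow_mult_distr, Rinv_mult, pow_inv.
    apply Rmult_le_compat.
    + left; apply Rinv_0_lt_compat; lra.
    + left; apply Rinv_0_lt_compat; lra.
    + replace (2 ^ k)%R with (/ (/ 2) ^ k)%R by (rewrite pow_inv; apply Rinv_inv).
      now apply Rinv_le_contravar.
    + now apply Rinv_le_contravar.
Qed.

Lemma Cmod_geometric_sum_le (u : nat -> C) (r : R) (n : nat) :
  (0 <= r <= / 2)%R -> u 0%nat = 1 -> (forall k, (Cmod (u k) <= r ^ k)%R) ->
  (Cmod (sum_n u n - 1) <= 2 * r)%R.
Proof.
  intros Hr H0 H.
  (* Subtracting [2 r^(n+1)] makes the induction close: the step needs [r^(n+1) (1 - 2r) >= 0],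
     which is where [r <= 1/2] enters. *)
  assert (Hb : (Cmod (sum_n u n - 1) <= 2 * r - 2 * r * r ^ n)%R).
  { induction n as [|n IH].
    - rewrite sum_O, H0. replace (1 - 1) with (RtoC 0) by ring. rewrite Cmod_0. simpl. lra.
    - rewrite sum_Sn. change plus with Cplus.
      replace (sum_n u n + u (S n) - 1) with ((sum_n u n - 1) + u (S n)) by ring.
      eapply Rle_trans; [apply Cmod_triangle |].
      specialize (H (S n)). simpl in H |- *.
      pose proof (pow_le r n (proj1 Hr)).
      assert (0 <= r * r ^ n * (1 - 2 * r))%R
        by (apply Rmult_le_pos; [apply Rmult_le_pos |]; lra).
      lra. }
  pose proof (pow_le r n (proj1 Hr)). nra.
Qed.


(** After [n] contiguous steps, [lhs n = p n * S'] with [S'] the sum at [z q^n]. As [p] is bounded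
    and [S'] tends to 1, [lhs] and [p] have the same limit. *)
Lemma q_gauss (q a b z S : C) :
  (Cmod q < 1)%R -> (forall n, qpoch (a * b * z) q n <> 0) ->
  is_series (gauss_term q a b z) S ->
  qpoch_inf (a * b * z) q * qpoch_inf z q * S
  = qpoch_inf (a * z) q * qpoch_inf (b * z) q.
Proof.
  intros Hq Hc HS.
  (* [K |z|] is the ratio in [Cmod_gauss_term_le]; [B] below bounds [p] uniformly. *)
  set (K := ((1 + Cmod a) * (1 + Cmod b) * (2 / (1 - Cmod q)))%R).
  set (p := fun n => qpoch (a * z) q n * qpoch (b * z) q n).
  set (B := (exp (Cmod (a * z) / (1 - Cmod q)) * exp (Cmod (b * z) / (1 - Cmod q)))%R).
  assert (Hz : Clim (fun n => z * q ^ n) 0).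
  { rewrite <- (Cmult_0_r z). now apply Clim_scal, Clim_pow. }
  assert (HR : is_lim_seq (fun n => K * Cmod (z * q ^ n))%R 0).
  { apply Clim_Cmod in Hz. rewrite Cmod_0 in Hz.
    replace 0%R with (K * 0)%R by ring.
    apply is_lim_seq_mult'; [apply is_lim_seq_const | exact Hz]. }
  assert (Habz : Clim (fun n => a * b * (z * q ^ n)) 0).
  { rewrite <- (Cmult_0_r (a * b)). now apply Clim_scal. }
  assert (H2 : (0 < / 2)%R) by lra.
  (* Beyond [N1] the term bound applies at [z q^n]; beyond [N2] its ratio is below [1/2], as
     [Cmod_geometric_sum_le] requires. *)
  destruct (proj1 (Clim_eps _ _) Habz (mkposreal _ H2)) as [N1 HN1].
  destruct (proj2 (is_lim_seq_spec _ _) HR (mkposreal _ H2)) as [N2 HN2].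
  simpl in HN1, HN2.
  assert (HK : (0 <= K)%R).
  { unfold K. pose proof (Cmod_ge_0 a). pose proof (Cmod_ge_0 b).
    repeat apply Rmult_le_pos; try lra. left. apply Rinv_0_lt_compat. lra. }
  set (lhs := fun n => qpoch (a * b * z) q n * qpoch z q n * S).
  assert (Hl : Clim lhs (qpoch_inf (a * b * z) q * qpoch_inf z q * S))
    by (apply Clim_mult; [apply Clim_mult; now apply Clim_qpoch | apply Clim_const]).
  assert (Hp : Clim p (qpoch_inf (a * z) q * qpoch_inf (b * z) q))
    by (apply Clim_mult; now apply Clim_qpoch).
  apply (Clim_unique lhs); [exact Hl |].
  apply (Clim_ext (fun n => p n + (lhs n - p n))); [intros n; ring |].
  rewrite <- (Cplus_0_r (qpoch_inf (a * z) q * qpoch_inf (b * z) q)).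
  apply Clim_plus; [exact Hp |].
  apply (Clim_decr_n (N1 + N2)).
  apply Clim_le with
    (v := fun n => (B * (2 * (K * Cmod (z * q ^ (n + (N1 + N2))%nat))))%R).
  - intros m. set (n := (m + (N1 + N2))%nat).
    destruct (gauss_contiguous_iter q a b z S n Hq Hc HS) as [S' [HS' E]].
    replace (lhs n - p n - 0) with (p n * (S' - 1)) by (unfold lhs, p; rewrite E; ring).
    rewrite Cmod_mult.
    assert (HKn : (0 <= K * Cmod (z * q ^ n))%R)
      by (apply Rmult_le_pos; [exact HK | apply Cmod_ge_0]).
    apply Rmult_le_compat; try apply Cmod_ge_0.
    + unfold p. rewrite Cmod_mult.
      apply Rmult_le_compat; auto using Cmod_ge_0, Cmod_qpoch_le_exp.
    + apply is_series_Clim in HS'. apply (Clim_dist_le _ _ _ _ HS').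
      intros k. apply Cmod_geometric_sum_le.
      * split; [exact HKn |]. specialize (HN2 n ltac:(unfold n; lia)).
        rewrite Rminus_0_r, Rabs_pos_eq in HN2 by exact HKn. lra.
      * unfold gauss_term. simpl. field.
      * intros j. apply Cmod_gauss_term_le; [exact Hq |].
        specialize (HN1 n ltac:(unfold n; lia)).
        replace (a * b * (z * q ^ n) - 0) with (a * b * (z * q ^ n)) in HN1 by ring.
        lra.
  - replace 0%R with (B * (2 * 0))%R by ring.
    apply is_lim_seq_mult'; [apply is_lim_seq_const |].
    apply is_lim_seq_mult'; [apply is_lim_seq_const |].
    now apply (is_lim_seq_incr_n (fun n => K * Cmod (z * q ^ n))%R).
Qed.

(** * Column sums of the double series *)

Lemma sum_n_eq_0 (u : nat -> C) (n : nat) :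
  (forall k, (k <= n)%nat -> u k = 0) -> sum_n u n = RtoC 0.
Proof.
  intros H. induction n as [|n IH].
  - rewrite sum_O. now apply H.
  - rewrite sum_Sn, IH, H by auto. apply Cplus_0_r.
Qed.

Lemma sum_n_leading_0 (u : nat -> C) (n k : nat) :
  (forall m, (m < n)%nat -> u m = 0) ->
  sum_n u (k + n) = sum_n (fun j => u (j + n)%nat) k.
Proof.
  intros H. induction k as [|k IH].
  - rewrite sum_O. simpl. destruct n as [|n].
    + apply sum_O.
    + rewrite sum_Sn, sum_n_eq_0 by (intros; apply H; lia). apply Cplus_0_l.
  - simpl. rewrite !sum_Sn, IH. reflexivity.
Qed.

Lemma sum_n_trailing_0 (u : nat -> C) (m n : nat) :
  (m <= n)%nat -> (forall k, (m < k)%nat -> u k = 0) -> sum_n u n = sum_n u m.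
Proof.
  intros Hmn H. induction Hmn as [|n Hmn IH]; [reflexivity |].
  rewrite sum_Sn, IH, H by lia. apply Cplus_0_r.
Qed.

(** With [m = k + n], splitting the symbols in [a] and [abz] at [n] turns the column into a multiple
    of the Gauss series with [a q^n] for [a] and the same [b], [z]. After [q_gauss], the infinite
    products are recombined by [qpoch_inf_split]. *)
Lemma column_sum (q a b z x l : C) (n : nat) :
  (Cmod q < 1)%R ->
  (forall k, qpoch (a * b * z) q k <> 0) ->
  (forall k, qpoch (a * z) q k <> 0) ->
  qpoch_inf (a * b * z) q <> 0 -> qpoch_inf z q <> 0 ->
  is_series (fun m =>
    if Nat.leb n m
    then qpoch a q m / qpoch (a * b * z) q m * z ^ m
         * (qpoch b q (m - n) / qpoch q q (m - n) * x)
    else RtoC 0) l ->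
  l = qpoch_inf (b * z) q * qpoch_inf (a * z) q
      / (qpoch_inf (a * b * z) q * qpoch_inf z q)
      * (qpoch a q n / qpoch (a * z) q n * z ^ n * x).
Proof.
  intros Hq Hc Haz Hci Hzi Hl. apply is_series_Clim, (Clim_incr_n n) in Hl.
  set (d := qpoch a q n * z ^ n * x).
  assert (Hs : Clim (fun k => d / qpoch (a * b * z) q n
    * sum_n (gauss_term q (a * q ^ n) b z) k) l).
  { revert Hl. apply Clim_ext. intros k. rewrite sum_n_leading_0.
    - rewrite <- (sum_n_mult_l (K := C_Ring)). apply sum_n_ext. intros j.
      rewrite (proj2 (Nat.leb_le n (j + n))), Nat.add_sub by lia.
      change mult with Cmult. rewrite Nat.add_comm, !qpoch_add, Cpow_add_r.
      unfold d, gauss_term.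
      replace (a * q ^ n * b * z) with (a * b * z * q ^ n) by ring.
      match goal with |- ?u = ?v => change (@eq C u v) end.
      field. repeat split.
      + now apply qpoch_q_neq_0.
      + now apply qpoch_neq_0_shift.
      + apply Hc.
    - intros m Hm. now rewrite (proj2 (Nat.leb_gt n m)). }
  (* If [d = 0], the column is identically zero and says nothing about convergence of the Gauss
     series, but both sides are then zero. Otherwise that convergence follows on dividing by [d]. *)
  destruct (Ceq_dec d 0) as [Hd | Hd].
  - replace (qpoch a q n / qpoch (a * z) q n * z ^ n * x)
      with (d / qpoch (a * z) q n) by (unfold d; field; apply Haz).
    rewrite Hd in Hs |- *.
    apply (Clim_unique _ _ _ Hs), (Clim_ext (fun _ => RtoC 0)).
    + intros k. field. apply Hc.
    + replace (qpoch_inf (b * z) q * qpoch_inf (a * z) q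
        / (qpoch_inf (a * b * z) q * qpoch_inf z q) * (0 / qpoch (a * z) q n))
        with (RtoC 0) by (field; auto).
      apply Clim_const.
  - assert (Hg : is_series (gauss_term q (a * q ^ n) b z)
      (qpoch (a * b * z) q n / d * l)).
    { apply is_series_Clim.
      apply (Clim_scal (qpoch (a * b * z) q n / d)) in Hs.
      revert Hs. apply Clim_ext. intros k. field. auto. }
    apply q_gauss in Hg; [| exact Hq |].
    + replace (a * q ^ n * b * z) with (a * b * z * q ^ n) in Hg by ring.
      replace (a * q ^ n * z) with (a * z * q ^ n) in Hg by ring.
      pose proof (qpoch_inf_split (a * b * z) q n Hq) as E.
      assert (Hi : qpoch_inf (a * b * z * q ^ n) q <> 0).
      { intros E0. apply Hci. rewrite E, E0. ring. }
      rewrite E, (qpoch_inf_split (a * z) q n Hq).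
      transitivity (qpoch_inf (a * b * z * q ^ n) q * qpoch_inf z q
        * (qpoch (a * b * z) q n / d * l) * d
        / (qpoch_inf (a * b * z * q ^ n) q * qpoch_inf z q * qpoch (a * b * z) q n)).
      { field. repeat split; auto. }
      rewrite Hg. unfold d. field. repeat split; auto.
    + intros k. replace (a * q ^ n * b * z) with (a * b * z * q ^ n) by ring.
      now apply qpoch_neq_0_shift.
Qed.

(** * Interchange of the order of summation and conclusion *)

Lemma Clim_sum_n (u : nat -> nat -> C) (l : nat -> C) (n : nat) :
  (forall j, is_series (u j) (l j)) ->
  Clim (fun m => sum_n (fun j => sum_n (u j) m) n) (sum_n l n).
Proof.
  intros H. induction n as [|n IH].
  - rewrite sum_O. apply (Clim_ext (sum_n (u 0%nat))); [intros m; now rewrite sum_O |].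
    apply is_series_Clim, H.
  - rewrite sum_Sn. apply (Clim_ext (fun m =>
      sum_n (fun j => sum_n (u j) m) n + sum_n (u (S n)) m));
      [intros m; now rewrite sum_Sn |].
    apply Clim_plus; [exact IH | apply is_series_Clim, H].
Qed.

Lemma filterlim_swap_index (s : nat -> nat -> C) (l : C) :
  filterlim (fun p : nat * nat => s (fst p) (snd p))
    (filter_prod eventually eventually) (locally l) ->
  filterlim (fun p : nat * nat => s (snd p) (fst p))
    (filter_prod eventually eventually) (locally l).
Proof.
  intros H P HP. destruct (H P HP) as [Q R HQ HR HQR].
  apply (Filter_prod _ _ _ R Q HR HQ). intros x y Hx Hy. exact (HQR y x Hy Hx).
Qed.

(** Both iterated sums equal the limit [s] of the rectangular partial sums: one inner bound is sent
    to infinity first, then the other. *)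
Lemma double_series_iterated (t : nat -> nat -> C) (r c : nat -> C) (L M : C) :
  ex_double_series t ->
  (forall m, is_series (t m) (r m)) ->
  (forall n, is_series (fun m => t m n) (c n)) ->
  is_series r L -> is_series c M -> L = M.
Proof.
  intros [[s Hs] _] Hr Hc HL HM. transitivity s; [| symmetry].
  - apply (double_limit_iterated (fun m n => sum_n (fun i => sum_n (t i) n) m) _ _ _ Hs)
      with (2 := proj1 (is_series_Clim _ _) HL).
    intros m. now apply Clim_sum_n.
  - apply (double_limit_iterated
      (fun n m => sum_n (fun i => sum_n (t i) n) m) _ _ _ (filterlim_swap_index
      (fun m n => sum_n (fun i => sum_n (t i) n) m) _ Hs))
      with (2 := proj1 (is_series_Clim _ _) HM).
    intros n. apply (Clim_ext (fun m => sum_n (fun j => sum_n (fun i => t i j) m) n)).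
    + intros m. symmetry. apply sum_n_switch.
    + now apply Clim_sum_n.
Qed.

Lemma is_series_finite (u : nat -> C) (m : nat) :
  (forall k, (m < k)%nat -> u k = 0) -> is_series u (sum_n u m).
Proof.
  intros H. apply is_series_Clim, (Clim_ext_loc (fun _ => sum_n u m) _ _ m).
  - intros n Hn. symmetry. now apply sum_n_trailing_0.
  - apply Clim_const.
Qed.

Theorem theorem6 :
  forall (q a b c : C) (alpha beta : nat -> C),
    (Cmod q < 1)%R ->
    (* no denominator vanishes *)
    a <> 0 -> b <> 0 ->
    (forall n : nat, qpoch c q n <> 0) ->
    (forall n : nat, qpoch (c / b) q n <> 0) ->
    qpoch_inf c q <> 0 ->
    qpoch_inf (c / (a * b)) q <> 0 ->
    (forall m : nat,
        beta m = sum_n (fun n => qpoch b q (m - n) / qpoch q q (m - n) * alpha n) m) ->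
    (* the double series over m >= n >= 0, extended by 0 to all pairs (m, n) *)
    ex_double_series (fun m n =>
      if Nat.leb n m
      then qpoch a q m / qpoch c q m * (c / (a * b)) ^ m
           * (qpoch b q (m - n) / qpoch q q (m - n) * alpha n)
      else 0) ->
    forall L M : C,
      is_series (fun m => qpoch a q m / qpoch c q m * (c / (a * b)) ^ m * beta m) L ->
      is_series (fun k => qpoch a q k / qpoch (c / b) q k * (c / (a * b)) ^ k * alpha k) M ->
      L = qpoch_inf (c / a) q * qpoch_inf (c / b) q
          / (qpoch_inf c q * qpoch_inf (c / (a * b)) q) * M.
Proof.
  intros q a b c alpha beta Hq Ha Hb Hc Hcb Hci Hzi Hbeta Hd L M HL HM.
  set (z := c / (a * b)) in *.
  (* In terms of [z], the parameters [c], [c/b], [c/a] become the products [abz], [az], [bz]. *)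
  assert (Ec : c = a * b * z) by (unfold z; field; auto).
  replace (c / b) with (a * z) in * by (unfold z; field; auto).
  replace (c / a) with (b * z) by (unfold z; field; auto).
  clearbody z. subst c.
  apply is_series_Clim, (Clim_scal (qpoch_inf (b * z) q * qpoch_inf (a * z) q
    / (qpoch_inf (a * b * z) q * qpoch_inf z q))) in HM.
  (* The rows add up to the terms of the series of [L]; the column sums are prescribed by
     [column_sum]. *)
  apply (double_series_iterated _ _ (fun n => qpoch_inf (b * z) q * qpoch_inf (a * z) q
    / (qpoch_inf (a * b * z) q * qpoch_inf z q)
    * (qpoch a q n / qpoch (a * z) q n * z ^ n * alpha n)) L _ Hd) with (3 := HL).
  - intros m. rewrite Hbeta, <- (sum_n_mult_l (K := C_Ring)).
    erewrite sum_n_ext_loc; [apply is_series_finite with (m := m) |].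
    + intros n Hn. now rewrite (proj2 (Nat.leb_gt n m)).
    + intros n Hn. simpl. now rewrite (proj2 (Nat.leb_le n m)).
  (* Regular convergence supplies some column sum [l], and [column_sum] identifies it. *)
  - intros n. destruct Hd as [_ [_ Hcol]]. destruct (Hcol n) as [l Hl].
    pose proof (column_sum _ _ _ _ _ _ _ Hq Hc Hcb Hci Hzi Hl) as E.
    rewrite E in Hl. exact Hl.
  - apply is_series_Clim. revert HM. apply Clim_ext. intros n.
    symmetry. apply (sum_n_mult_l (K := C_Ring)).
Qed.
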